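(* Let $(\mathcal{X},\mathcal{F},\sigma)$ be a probability space with an $\alpha$-homogeneous atomic filtration, $0<\alpha\le1/2$, and let $f\in L^1(\mathcal{X})$ be real-valued with $Sf\in L^\infty$ and $\mathbb{E}f=0$. Then for every $\lambda>0$ \[ \bigl|\{x\in\mathcal{X}: f^*(x)>\lambda\}\bigr|\le 2e^{-\alpha\lambda^2/\|Sf\|_\infty^2}. \]
   Context: An atomic filtration on a probability space $(\mathcal{X},\mathcal{F},\sigma)$ is an increasing sequence of $\sigma$-algebras $\mathcal{F}_n\subset\mathcal{F}$, $n\ge0$, with $\mathcal{F}_0=\{\varnothing,\mathcal{X}\}$, $\mathcal{F}$ generated by the $\mathcal{F}_n$, and such that for each $n$ there is a countable collection $\mathcal{D}_n$ of disjoint sets (''cubes'') with every set of $\mathcal{F}_n$ a union of sets of $\mathcal{D}_n$. Write $\mathcal{D}=\bigcup_n\mathcal{D}_n$, $|A|=\sigma(A)$, and for $Q\in\mathcal{D}_n$ let $\operatorname{ch}Q=\{R\in\mathcal{D}_{n+1}:R\subset Q\}$. The filtration is $\alpha$-homogeneous if $|Q'|\ge\alpha|Q|$ for every cube $Q$ and every $Q'\in\operatorname{ch}Q$. For $|A|>0$, $\langle f\rangle_A=|A|^{-1}\int_A f$; $\mathbb{E}f=\langle f\rangle_{\mathcal{X}}$. Let $\mathbf{E}_Q f=\langle f\rangle_Q\mathbf{1}_Q$, $\mathbf{E}_nf=\sum_{Q\in\mathcal{D}_n}\mathbf{E}_Qf$, $\Delta_Q=\sum_{R\in\operatorname{ch}Q}\mathbf{E}_R-\mathbf{E}_Q$,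 and $S f=\bigl(\sum_{Q\in\mathcal{D}}|\Delta_Q f|^2\bigr)^{1/2}$. The martingale maximal function is $f^*(x)=\sup_{n\ge0}|\mathbf{E}_nf(x)|$. *)

(* Defs.v *)
From HB Require Import structures.
From mathcomp Require Import all_boot all_order all_algebra.
From mathcomp Require Import all_classical all_reals all_analysis ess_sup_inf.
Set Implicit Arguments. Unset Strict Implicit. Unset Printing Implicit Defensive.
Import Order.TTheory GRing.Theory Num.Theory.
Import numFieldNormedType.Exports.
Local Open Scope classical_set_scope.
Local Open Scope ring_scope.

Section martingale_defs.
Context {d : measure_display} {T : measurableType d} {R : realType}.
Variable P : probability T R.

(* <f>_A = |A|^{-1} \int_A f  (only used for |A| > 0; equals 0 if |A| = 0) *)
Definition avg (A : set T) (f : T -> R) : R := Rintegral P A f / fine (P A).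

Definition condE_cube (Q : set T) (f : T -> R) (x : T) : R :=
  avg Q f * \1_Q x.

(* E_n f = sum_{Q in D_n} E_Q f  (pointwise, at most one nonzero term since
   the cubes of D_n are disjoint) *)
Definition condE (D : nat -> set (set T)) (n : nat) (f : T -> R) (x : T) : R :=
  \sum_(Q \in D n) condE_cube Q f x.

Definition children (D : nat -> set (set T)) (n : nat) (Q : set T) : set (set T) :=
  [set Q' | D n.+1 Q' /\ Q' `<=` Q].

Definition Delta (D : nat -> set (set T)) (n : nat) (Q : set T) (f : T -> R)
  (x : T) : R :=
  \sum_(Q' \in children D n Q) condE_cube Q' f x - condE_cube Q f x.

(* S f = (sum_{Q in D} |Delta_Q f|^2)^{1/2}, the sum over D = U_n D_n
   taken over the pairs (n, Q) with Q in D_n *)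
Definition square_fun (D : nat -> set (set T)) (f : T -> R) (x : T) : \bar R :=
  sqrte (\sum_(0 <= n <oo) (\sum_(Q \in D n) `|Delta D n Q f x| ^+ 2)%:E)%E.

Definition mart_max (D : nat -> set (set T)) (f : T -> R) (x : T) : \bar R :=
  ereal_sup [set (`|condE D n f x|)%:E | n in [set: nat]].

Definition atomic_filtration (F : nat -> set (set T))
  (D : nat -> set (set T)) : Prop :=
  [/\ (forall n, sigma_algebra setT (F n)),
      (forall n, F n `<=` measurable),
      (forall n, F n `<=` F n.+1),
      F 0%N = [set A | A = set0 \/ A = setT] &
      (@measurable d T = <<s \bigcup_n F n >>)] /\
      (forall n, [/\ countable (D n),
         (forall Q, D n Q -> F n Q),
         (forall Q Q', D n Q -> D n Q' -> Q <> Q' -> Q `&` Q' = set0) &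
         (forall A, F n A -> exists S, S `<=` D n /\ A = \bigcup_(Q in S) Q)]).

Definition homogeneous (D : nat -> set (set T)) (alpha : R) : Prop :=
  forall n Q Q', D n Q -> children D n Q Q' -> (alpha%:E * P Q <= P Q')%E.

End martingale_defs.

(* Main.v *)
Require Import Defs.
From HB Require Import structures.
From mathcomp Require Import all_boot all_order all_algebra finmap ring lra.
From mathcomp Require Import all_classical all_reals all_analysis ess_sup_inf.
Import Order.TTheory GRing.Theory Num.Theory.
Import numFieldNormedType.Exports.
Set Implicit Arguments. Unset Strict Implicit. Unset Printing Implicit Defensive.
Local Open Scope classical_set_scope.
Local Open Scope ring_scope.

(** Write [X_n = E_n f] and [S_n^2 = sum_(k < n) (X_(k+1) - X_k)^2].  The key is that
    [exp (t X_n - t^2 S_n^2 / (4 alpha))] is a supermartingale, i.e. that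
    [E exp (x - x^2 / (4 alpha)) <= 1] for a centered [x] all of whose atoms have
    probability at least [alpha].  Stopping at the first time [X_n > lam] then gives
    [P (sup X_n > lam) <= exp (- t lam + t^2 B^2 / (4 alpha))] with [B = ||S f||_oo],
    and [t = 2 alpha lam / B^2] is the optimal choice; the factor 2 comes from [- f].

    With [x = 2 alpha (1 - m)] the one-step inequality reads
    [E exp (- alpha m^2) <= exp (- alpha)] for [E m = 1].  The gaussian is concave up to
    its inflection point and convex beyond it, so moving every atom but the largest
    one below the inflection point (at the expense of the largest one), and then
    merging them, only increases the left-hand side: this leaves two atoms, and
    that case is a one-variable maximization. *)

(** * Two-point inequality *)

Section real_inequalities.
Context {R : realType}.
Implicit Types a b x y s t p r : R.

(** One formula for all derivatives below: [b = 0] gives [expR z] and [expR (- z)], [a = 0] the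
    gaussian. *)
Lemma is_derive_expR_quadratic a b x :
  is_derive x (1 : R) (fun y => expR (a * y + b * y ^+ 2))
    ((a + 2 * b * x) * expR (a * x + b * x ^+ 2)).
Proof.
have h : is_derive x (1 : R) (fun y => a * y + b * y ^+ 2) (a + 2 * b * x).
  by apply: is_derive_eq; rewrite /GRing.scale/=; ring.
apply: (@is_derive_eq _ _ _ _ _ _ _ _ (is_derive1_comp (f := expR) _ h)).
by rewrite mulrC.
Qed.

Lemma mean_value_le (f df : R -> R) a b : a <= b ->
  (forall x, is_derive x (1 : R) f (df x)) ->
  exists2 c, a <= c <= b & f b - f a = df c * (b - a).
Proof.
move=> ab fdf.
have [c cab ->] : exists2 c, c \in `[a, b]%R & f b - f a = df c * (b - a).
  apply: MVT_segment => // ; apply: continuous_subspaceT => x.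
  by apply/differentiable_continuous/derivable1_diffP; case: (fdf x).
by exists c.
Qed.

(* The left-hand side has derivative [- x ^ 2 * expR (x + x ^ 2 / 2)]. *)
Lemma mul_expR_quadratic_nincr x y : x <= y ->
  (1 - y) * expR (y + y ^+ 2 / 2) <= (1 - x) * expR (x + x ^+ 2 / 2).
Proof.
move=> xy.
pose f z : R := (1 - z) * expR (1 * z + 2^-1 * z ^+ 2).
have df z : is_derive z (1 : R) f (- z ^+ 2 * expR (1 * z + 2^-1 * z ^+ 2)).
  have := is_derive_expR_quadratic 1 2^-1 z => h.
  apply: is_derive_eq; rewrite /GRing.scale/=.
  by field.
have [c _] := mean_value_le xy df.
have E z : (1 - z) * expR (z + z ^+ 2 / 2) = f z.
  by rewrite /f mul1r [2^-1 * _]mulrC.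
move=> /eqP; rewrite !E subr_eq => /eqP ->.
rewrite gerDr mulr_le0_ge0 ?subr_ge0//.
by rewrite mulNr oppr_le0 mulr_ge0 ?sqr_ge0 ?expR_ge0.
Qed.

Lemma mul_expR_quadratic_le1 x : 0 <= x -> (1 - x) * expR (x + x ^+ 2 / 2) <= 1.
Proof.
move=> /mul_expR_quadratic_nincr; rewrite subr0 expr0n/= mul0r addr0 expR0.
by rewrite mulr1.
Qed.

(** Scaled by [expR (- t)], the difference of the sides vanishes at [0] and has derivative
    [z * (expR z - expR (- z))], positive for [z > 0]. *)
Lemma mul_expR_double_lt t : 0 < t -> (1 - t) * expR (2 * t) < 1 + t.
Proof.
move=> t0.
pose f z : R := (1 + z) * expR ((-1) * z + 0 * z ^+ 2)
   - (1 - z) * expR (1 * z + 0 * z ^+ 2).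
have df z : is_derive z (1 : R) f (z * (expR z - expR (- z))).
  have h1 := is_derive_expR_quadratic 1 0 z.
  have h2 := is_derive_expR_quadratic (-1) 0 z.
  apply: is_derive_eq; rewrite /GRing.scale/= !mul0r !addr0 !mul1r !mulN1r.
  by ring.
have cf : {within `[0, t], continuous f}.
  apply: continuous_subspaceT => x.
  by apply/differentiable_continuous/derivable1_diffP; case: (df x).
have [c] := MVT t0 (fun x _ => df x) cf.
rewrite in_itv/= => /andP[c0 _].
rewrite /f !mul0r !addr0 !mul1r !mulN1r oppr0 expR0 !addr0 !mulr1 subrr subr0.
move=> e.
have : 0 < (1 + t) * expR (- t) - (1 - t) * expR t.
  rewrite e mulr_gt0// mulr_gt0// subr_gt0 ltr_expR; lra.
move=> e1; rewrite -subr_gt0 [2 * t](_ : _ = t + t); last by ring.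
rewrite expRD (_ : 1 + t - _ = ((1 + t) * expR (- t) - (1 - t) * expR t) * expR t
  + (1 + t) * (1 - expR (- t) * expR t)); last by ring.
by rewrite -expRD addNr expR0 subrr mulr0 addr0 mulr_gt0 ?expR_gt0.
Qed.

(* The hypothesis says that [s] is a critical point of the left-hand side of the
   conclusion. *)
Lemma two_point_critical_le r s : 1 <= r -> s != 0 ->
  (1 + r * s) * expR (- ((2 * r) * s + r ^+ 2 * s ^+ 2) / (1 + r))
    = (1 - s) * expR ((2 * s - s ^+ 2) / (1 + r)) ->
  expR (- ((2 * r) * s + r ^+ 2 * s ^+ 2) / (1 + r))
    + r * expR ((2 * s - s ^+ 2) / (1 + r)) <= 1 + r.
Proof.
move=> r1 s0.
set A := - _ / _; set B := (_ - _) / _ => e.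
have r0 : 0 < 1 + r by lra.
have rn0 : 1 + r != 0 by rewrite gt_eqF.
have eA := expR_gt0 A; have eB := expR_gt0 B.
have [sneg|spos] := ltP s 0.
  (* No negative critical point: for [s = - t] criticality reads
     [(1 - r * t) * expR (A - B) = 1 + t], while [r >= 1] gives [1 - r * t <= 1 - t] and
     [A - B <= 2 * t], against [mul_expR_double_lt]. *)
  exfalso; have [t se] : exists t, s = - t by exists (- s); rewrite opprK.
  have t0 : 0 < t by rewrite -oppr_lt0 -se.
  have rt1 : 0 < 1 - r * t.
    have -> : 1 - r * t = 1 + r * s by rewrite se mulrN.
    by rewrite -(pmulr_lgt0 _ eA) e mulr_gt0// subr_gt0 (lt_trans sneg).
  have AB : A - B = 2 * t - (r - 1) * t ^+ 2.
    by rewrite /A /B se; field.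
  have e' : (1 - r * t) * expR (A - B) = 1 + t.
    rewrite expRD expRN mulrA -[1 - r * t](_ : 1 + r * s = _); last by rewrite se mulrN.
    by rewrite e mulfK ?gt_eqF// se opprK.
  have h1 : (1 - r * t) * expR (A - B) <= (1 - t) * expR (2 * t).
    apply: ler_pM; [exact: ltW|exact: expR_ge0|nra|].
    rewrite ler_expR AB gerBl mulr_ge0 ?sqr_ge0//; lra.
  by have := le_lt_trans h1 (mul_expR_double_lt t0); rewrite e' ltxx.
have {s0}spos : 0 < s by rewrite lt_neqAle eq_sym s0.
have rs : 0 < 1 + r * s by nra.
have rsn0 : 1 + r * s != 0 by rewrite gt_eqF.
have s1 : 0 < 1 - s by rewrite -(pmulr_lgt0 _ eB) -e mulr_gt0.
(* Criticality makes [expR A] a multiple of [expR B], and the sum becomes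
   [(1 + r) * (1 - x) * expR B]; so [B <= x + x ^+ 2 / 2] suffices. *)
pose x := s / (1 + r * s).
have x0 : 0 <= x by rewrite divr_ge0 ?ltW.
have Bx : B <= x + x ^+ 2 / 2.
  rewrite -subr_ge0.
  have -> : x + x ^+ 2 / 2 - B = s *
     (s * (1 + r) / 2 - (1 + r * s) * (1 - s) * (1 - r * (1 - s)))
       / ((1 + r) * (1 + r * s) ^+ 2).
    by rewrite /x /B; field; rewrite rsn0 rn0.
  apply: divr_ge0; last by rewrite mulr_ge0 ?sqr_ge0 ?(ltW r0).
  apply: mulr_ge0; [exact: ltW|rewrite subr_ge0].
  have h1 : 1 - r * (1 - s) <= s by nra.
  have h2 : (1 + r * s) * (1 - s) <= (1 + r) / 2 by nra.
  have h3 : 0 <= (1 + r * s) * (1 - s) by rewrite mulr_ge0 ?ltW.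
  apply: (@le_trans _ _ ((1 + r * s) * (1 - s) * s)); first exact: ler_wpM2l.
  rewrite [leRHS](_ : _ = (1 + r) / 2 * s); last by ring.
  by apply: ler_wpM2r => //; rewrite ltW.
have -> : expR A = (1 - s) / (1 + r * s) * expR B.
  by apply: (mulfI rsn0); rewrite e; field.
rewrite -mulrDl [X in X * _](_ : _ = (1 + r) * (1 - x)); last first.
  by rewrite /x; field.
rewrite -mulrA -[leRHS]mulr1 ler_pM2l//.
have x1 : 0 <= 1 - x.
  rewrite subr_ge0 ler_pdivrMr// mul1r; nra.
apply: le_trans (mul_expR_quadratic_le1 x0).
by rewrite ler_wpM2l// ler_expR.
Qed.

(** A maximum over [[-(2 / r), 2]] exists; it is either an interior critical point or an endpoint,
    where both exponents are nonpositive. *)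
Lemma two_point_expR_le r s : 1 <= r ->
  expR (- ((2 * r) * s + r ^+ 2 * s ^+ 2) / (1 + r))
    + r * expR ((2 * s - s ^+ 2) / (1 + r)) <= 1 + r.
Proof.
move=> r1.
have r0 : 0 < r by lra.
have r10 : 0 < 1 + r by lra.
have rn0 : r != 0 by rewrite gt_eqF.
have r1n0 : 1 + r != 0 by rewrite gt_eqF.
pose A z : R := - ((2 * r) * z + r ^+ 2 * z ^+ 2) / (1 + r).
pose B z : R := (2 * z - z ^+ 2) / (1 + r).
pose F z := expR (A z) + r * expR (B z).
rewrite -[leLHS]/(F s).
(* [A] vanishes at [-(2 / r)] and [0], [B] at [0] and [2]; outside the open interval neither is
   positive. *)
have out z : ~~ (z \in `]-(2 / r), 2[) -> F z <= 1 + r.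
  move=> zout; apply: lerD; last rewrite -[leRHS]mulr1 ler_pM2l//;
    rewrite -[leRHS]expR0 ler_expR ler_pdivrMr// mul0r.
    have -> : - (2 * r * z + r ^+ 2 * z ^+ 2) = - (r ^+ 2 * z * (z + 2 / r)).
      by field.
    rewrite oppr_le0 -mulrA mulr_ge0 ?sqr_ge0//.
    move: zout; rewrite in_itv/= negb_and -!leNgt => /orP[z2|z2].
      have : 0 < 2 / r by rewrite divr_gt0.
      by move=> ?; rewrite mulr_le0//; lra.
    have : 0 < 2 / r by rewrite divr_gt0.
    by move=> ?; rewrite mulr_ge0//; lra.
  rewrite (_ : _ - _ = - (z * (z - 2))); last by ring.
  have : 0 < 2 / r by rewrite divr_gt0.
  move: zout; rewrite in_itv/= negb_and -!leNgt => /orP[z2|z2] r2.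
    by rewrite oppr_le0 mulr_le0//; lra.
  by rewrite oppr_le0 mulr_ge0//; lra.
have [sin|/out//] := boolP (s \in `]-(2 / r), 2[).
have dF z : is_derive z (1 : R) F
    (- (2 * r) / (1 + r) * ((1 + r * z) * expR (A z) - (1 - z) * expR (B z))).
  have E1 : (fun z => expR (- (2 * r) / (1 + r) * z + - (r ^+ 2) / (1 + r) * z ^+ 2))
      = (fun z => expR (A z)).
    by apply/funext => w; congr expR; rewrite /A; field.
  have E2 : (fun z => expR (2 / (1 + r) * z + (- 1 / (1 + r)) * z ^+ 2))
      = (fun z => expR (B z)).
    by apply/funext => w; congr expR; rewrite /B; field.
  have := is_derive_expR_quadratic (- (2 * r) / (1 + r)) (- (r ^+ 2) / (1 + r)) z.
  have := is_derive_expR_quadratic (2 / (1 + r)) (- 1 / (1 + r)) z.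
  have /= -> := congr1 (fun f => f z) E1.
  have /= -> := congr1 (fun f => f z) E2.
  rewrite E1 E2 => h2 h1.
  apply: is_derive_eq; rewrite /GRing.scale/=.
  by field.
have cF : {within `[-(2 / r), 2], continuous F}.
  apply: continuous_subspaceT => x.
  by apply/differentiable_continuous/derivable1_diffP; case: (dF x).
have l2 : -(2 / r) <= 2.
  by have : 0 < 2 / r by [rewrite divr_gt0]; lra.
have [c cin cmax] := EVT_max l2 cF.
apply: (@le_trans _ _ (F c)); first by apply: cmax; exact: subset_itv_oo_cc.
have [cin'|/out//] := boolP (c \in `]-(2 / r), 2[).
have := derive1_at_max l2 (fun t _ => @ex_derive _ _ _ _ _ _ _ (dF t)) cin'
  (fun t tin => cmax t (subset_itv_oo_cc tin)).
move=> dF0; have := dF c => /(@derive_val _ _ _ _ _ _ _).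
rewrite (derive_val (is_derive := dF0)) => /esym/eqP.
rewrite mulf_eq0 mulf_eq0 invr_eq0 (negPf r1n0) orbF oppr_eq0 mulf_eq0 pnatr_eq0 /=.
rewrite (negPf rn0) /= subr_eq0 => /eqP crit.
have [c0|c0] := eqVneq c 0; last exact: two_point_critical_le.
by rewrite /F /A /B c0 expr0n/= !mulr0 subr0 addr0 oppr0 !mul0r expR0 mulr1.
Qed.

(** Take [r] the ratio of the weights, so that [p <= 1 / 2] means [r >= 1], and [s = a * (x - y)].
    Up to the term [- a], the exponents are those of [two_point_expR_le] if [p = a], and at most
    those if [p > a]. *)
Lemma gauss_two_point_half_le a p x y : 0 < a -> a <= p -> p <= 1 / 2 ->
  p * x + (1 - p) * y = 1 ->
  p * expR (- a * x ^+ 2) + (1 - p) * expR (- a * y ^+ 2) <= expR (- a).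
Proof.
move=> a0 ap p2 pxy.
have p0 : 0 < p by lra.
have pn0 : p != 0 by rewrite gt_eqF.
pose r := (1 - p) / p.
have rE : 1 + r = p^-1 by rewrite /r; field.
have r1 : 1 <= r by rewrite /r ler_pdivlMr//; lra.
have := two_point_expR_le (a * (x - y)) r1.
rewrite rE invrK.
set A := - _ * p; set B := _ * p => h.
have xE : x = 1 + (1 - p) * (x - y) by nra.
have yE : y = 1 - p * (x - y) by nra.
have hx : - a * x ^+ 2 <= - a + A.
  rewrite -subr_ge0.
  rewrite [X in X ^+ 2]xE [X in 0 <= X](_ : _ =
    (1 - p) ^+ 2 * (x - y) ^+ 2 * a * (p - a) / p); last first.
    by rewrite /A /r; field.
  apply: divr_ge0; last exact: ltW.
  apply: mulr_ge0; last by rewrite subr_ge0.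
  apply: mulr_ge0; last exact: ltW.
  by rewrite -exprMn sqr_ge0.
have hy : - a * y ^+ 2 <= - a + B.
  rewrite -subr_ge0.
  rewrite [X in X ^+ 2]yE [X in 0 <= X](_ : _ = a * p * (x - y) ^+ 2 * (p - a)); last first.
    by rewrite /B; ring.
  apply: mulr_ge0; last by rewrite subr_ge0.
  apply: mulr_ge0; last exact: sqr_ge0.
  by rewrite ltW// mulr_gt0.
apply: (@le_trans _ _ (p * expR (- a + A) + (1 - p) * expR (- a + B))).
  apply: lerD; rewrite ler_wpM2l ?ler_expR//; lra.
rewrite !expRD (_ : _ + _ = p * expR (- a) * (expR A + r * expR B)); last first.
  by rewrite /r; field.
rewrite -[leRHS](_ : p * expR (- a) * p^-1 = _); last by field.
by rewrite ler_pM2l// mulr_gt0 ?expR_gt0.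
Qed.

Lemma gauss_two_point_le a p x y : 0 < a -> a <= p -> a <= 1 - p ->
  p * x + (1 - p) * y = 1 ->
  p * expR (- a * x ^+ 2) + (1 - p) * expR (- a * y ^+ 2) <= expR (- a).
Proof.
move=> a0 ap a1p pxy; have [p2|p2] := leP p (1 / 2).
  exact: gauss_two_point_half_le.
rewrite addrC -{2}[p](subKr 1); apply: gauss_two_point_half_le => //.
  by lra.
by rewrite subKr addrC.
Qed.

End real_inequalities.

(** * Gaussian averages *)

Section gauss.
Context {R : realType}.
Variable a : R.
Hypothesis a0 : 0 < a.
Implicit Types x y z s : R.

Definition gauss x := expR (- a * x ^+ 2).
(** Minus the derivative of [gauss], hence nonnegative for [x >= 0]. *)
Definition gauss_slope x := 2 * a * x * gauss x.

Lemma gauss_gt0 x : 0 < gauss x. Proof. exact: expR_gt0. Qed.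

Lemma gauss_slope_ge0 x : 0 <= x -> 0 <= gauss_slope x.
Proof.
move=> x0; rewrite /gauss_slope mulr_ge0 ?(ltW (gauss_gt0 _))//.
by rewrite mulr_ge0// mulr_ge0// ltW.
Qed.

Lemma gauss_mean_value x y : x <= y ->
  exists2 c, x <= c <= y & gauss y - gauss x = - gauss_slope c * (y - x).
Proof.
move=> xy; apply: (mean_value_le (df := fun c => - gauss_slope c)) => // z.
have := is_derive_expR_quadratic 0 (- a) z.
rewrite (_ : (fun y => expR (0 * y + - a * y ^+ 2)) = gauss); last first.
  by apply/funext => w; rewrite mul0r add0r.
move=> h; apply: is_derive_eq.
by rewrite /gauss_slope /gauss mul0r !add0r; ring.
Qed.

Lemma gauss_ratio x y : gauss y = gauss x * expR (a * (x ^+ 2 - y ^+ 2)).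
Proof. by rewrite /gauss -expRD; congr expR; ring. Qed.

(** The hypothesis on [y] places it before the inflection point. Bounding the ratio of the gaussians
    by [1 + u <= expR u] leaves a polynomial inequality with factor [y - x]. *)
Lemma gauss_slope_incr x y : 0 <= x -> x <= y -> 2 * a * y ^+ 2 <= 1 ->
  gauss_slope x <= gauss_slope y.
Proof.
move=> x0 xy ay; rewrite /gauss_slope -!mulrA !ler_pM2l//.
rewrite (gauss_ratio x y) mulrCA mulrC ler_wpM2l ?(ltW (gauss_gt0 _))//.
apply: (@le_trans _ _ (y * (1 + a * (x ^+ 2 - y ^+ 2)))); last first.
  by rewrite ler_wpM2l ?expR_ge0 ?(le_trans x0)// expR_ge1Dx.
rewrite -subr_ge0 (_ : _ - _ = (y - x) * (1 - a * y ^+ 2 - a * (x * y))); last by ring.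
rewrite mulr_ge0 ?subr_ge0//.
have : a * (x * y) <= a * y ^+ 2 by rewrite ler_pM2l// expr2 ler_wpM2r// (le_trans x0).
lra.
Qed.

Lemma gauss_slope_decr x y : 0 <= x -> x <= y -> 1 <= 2 * a * x ^+ 2 ->
  gauss_slope y <= gauss_slope x.
Proof.
move=> x0 xy ay; rewrite /gauss_slope -!mulrA !ler_pM2l//.
rewrite (gauss_ratio y x) [leRHS]mulrCA [leLHS]mulrC ler_wpM2l ?(ltW (gauss_gt0 _))//.
apply: (@le_trans _ _ (x * (1 + a * (y ^+ 2 - x ^+ 2)))); last first.
  by rewrite ler_wpM2l// expR_ge1Dx.
rewrite -subr_ge0 (_ : _ - _ = (y - x) * (a * x ^+ 2 + a * (x * y) - 1)); last by ring.
rewrite mulr_ge0 ?subr_ge0//.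
have : a * x ^+ 2 <= a * (x * y) by rewrite ler_pM2l// expr2 ler_wpM2l.
lra.
Qed.

Lemma gauss_nincr x y : 0 <= x -> x <= y -> gauss y <= gauss x.
Proof.
move=> x0 xy; rewrite ler_expR !mulNr lerN2 ler_pM2l//.
by rewrite lerXn2r// nnegrE// (le_trans x0).
Qed.

Lemma gauss_le0 x : gauss x <= gauss 0.
Proof.
by rewrite ler_expR expr0n/= mulr0 mulNr oppr_le0 mulr_ge0 ?sqr_ge0// ltW.
Qed.

(** Gain from lowering an atom from [x] to [s]: the slope decreases beyond [s], so the gain per unit
    length is at least the slope at [y], which will be the largest atom. *)
Lemma gauss_clip_le s x y : 0 <= s -> 1 <= 2 * a * s ^+ 2 -> s <= x -> x <= y ->
  gauss x + gauss_slope y * (x - s) <= gauss s.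
Proof.
move=> s0 as1 sx xy.
have [c /andP[sc cx]] := gauss_mean_value sx.
move=> /eqP; rewrite subr_eq => /eqP ->.
rewrite addrAC -mulrDl gerDr mulr_le0_ge0 ?subr_ge0// addrC subr_le0.
apply: gauss_slope_decr; [exact: le_trans sc|exact: le_trans xy|].
apply: le_trans as1 _; rewrite ler_pM2l ?mulr_gt0//.
by rewrite lerXn2r// nnegrE (le_trans s0).
Qed.

(** Cost of pushing the largest atom outwards: at most its slope per unit length, the rate gained in
    [gauss_clip_le]. *)
Lemma gauss_convex_tangent_le x y : 0 <= x -> 1 <= 2 * a * x ^+ 2 -> x <= y ->
  gauss x - gauss_slope x * (y - x) <= gauss y.
Proof.
move=> x0 ax1 xy.
have [c /andP[xc cy]] := gauss_mean_value xy.
move=> /eqP; rewrite subr_eq => /eqP ->.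
rewrite addrC lerD2r mulNr lerN2 ler_wpM2r ?subr_ge0//.
exact: gauss_slope_decr.
Qed.

(** On [[0, s]] this is concavity. For negative [x], [gauss x <= gauss 0], and the nonincreasing
    tangent line is at least as high at [x] as at [0]. *)
Lemma gauss_tangent_le s z x : 0 <= z -> z <= s -> x <= s ->
  2 * a * s ^+ 2 <= 1 -> gauss x <= gauss z - gauss_slope z * (x - z).
Proof.
move=> z0 zs xs as1.
have le1 c : 0 <= c -> c <= s -> 2 * a * c ^+ 2 <= 1.
  move=> c0 cs; apply: le_trans as1; rewrite ler_pM2l ?mulr_gt0//.
  by rewrite lerXn2r// nnegrE (le_trans c0).
have below y : 0 <= y -> y <= z -> gauss y <= gauss z - gauss_slope z * (y - z).
  move=> y0 yz; have [c /andP[yc cz] e] := gauss_mean_value yz.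
  have : gauss_slope c * (z - y) <= gauss_slope z * (z - y).
    rewrite ler_wpM2r ?subr_ge0//; apply: gauss_slope_incr => //.
      exact: le_trans yc.
    exact: le1.
  by move: e; rewrite mulNr !mulrBr; lra.
have [x0|x0] := ltP x 0.
  apply: (le_trans (gauss_le0 x)); apply: (le_trans (below 0 (lexx 0) z0)).
  rewrite lerD2l lerN2 ler_wpM2l ?gauss_slope_ge0//; lra.
have [/below->//|zx] := leP x z.
have [c /andP[zc cx] e] := gauss_mean_value (ltW zx).
have : gauss_slope z * (x - z) <= gauss_slope c * (x - z).
  rewrite ler_wpM2r ?subr_ge0 ?(ltW zx)//; apply: gauss_slope_incr => //.
  apply: le1; first exact: le_trans zc.
  exact: le_trans xs.
by move: e; rewrite mulNr; lra.
Qed.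

End gauss.

(** * Reduction of a finite gaussian average to two atoms *)

Lemma exists_argmax_seq (R : realDomainType) (I : eqType) (r : seq I) (m : I -> R) :
  r != [::] -> exists2 i, i \in r & forall j, j \in r -> m j <= m i.
Proof.
elim: r => // i r IH _; have [->|/IH[k kr kmax]] := eqVneq r [::].
  by exists i; rewrite ?mem_head// => j; rewrite inE => /eqP ->.
have [ik|ki] := leP (m i) (m k).
  exists k; first by rewrite inE kr orbT.
  by move=> j; rewrite inE => /predU1P[->//|/kmax].
exists i; first exact: mem_head.
move=> j; rewrite inE => /predU1P[->//|/kmax jk].
exact: le_trans jk (ltW ki).
Qed.

Lemma gauss_average_le (R : realType) (I : eqType) (r : seq I) (p m : I -> R) (a : R) :
  0 < a -> a <= 1 / 2 -> uniq r -> (forall i, i \in r -> a <= p i) ->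
  \sum_(i <- r) p i = 1 -> \sum_(i <- r) p i * m i = 1 ->
  \sum_(i <- r) p i * gauss a (m i) <= gauss a 1.
Proof.
move=> a0 a2 ur pa p1 pm1.
have p0 i : i \in r -> 0 <= p i by move=> /pa; apply: le_trans; exact: ltW.
have rn0 : r != [::].
  by apply/eqP => r0; move: p1; rewrite r0 big_nil => /eqP; rewrite eq_sym oner_eq0.
have [i0 i0r mmax] := exists_argmax_seq m rn0.
(* The positive inflection point; [a <= 1 / 2] puts it at or beyond the mean [1]. *)
pose s : R := Num.sqrt (2 * a)^-1.
have a20 : 0 < 2 * a by rewrite mulr_gt0.
have s2 : 2 * a * s ^+ 2 = 1.
  by rewrite sqr_sqrtr ?invr_ge0 ?(ltW a20)// divff// gt_eqF.
have s0 : 0 <= s by exact: sqrtr_ge0.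
have s1 : 1 <= s.
  rewrite -sqrtr1 ler_sqrt ?invr_ge0 ?(ltW a20)// invf_ge1//; lra.
(* Jensen's inequality for atoms at most [s] with mean [z], by averaging the tangent bound at
   [z]. *)
have tangent (P : pred I) z (n : I -> R) : 0 <= z -> z <= s ->
    (forall i, P i -> n i <= s) ->
    \sum_(i <- r | P i) p i * n i = z * \sum_(i <- r | P i) p i ->
    \sum_(i <- r | P i) p i * gauss a (n i) <= (\sum_(i <- r | P i) p i) * gauss a z.
  move=> z0 zs ns mean.
  apply: (@le_trans _ _ (\sum_(i <- r | P i) p i * (gauss a z - gauss_slope a z * (n i - z)))).
    rewrite big_seq_cond [leRHS]big_seq_cond; apply: ler_sum => i /andP[ir Pi].
    rewrite ler_wpM2l ?p0//; apply: (@gauss_tangent_le _ _ a0 s) => //; first exact: ns.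
    by rewrite s2.
  rewrite (eq_bigr (fun i => p i * (gauss a z + gauss_slope a z * z)
     - gauss_slope a z * (p i * n i))); last by move=> i _; ring.
  by rewrite sumrB -mulr_suml -mulr_sumr mean le_eqVlt; apply/orP; left; apply/eqP; ring.
have [Ms|sM] := leP (m i0) s.
  have := tangent (mem r) 1 m ler01 s1 (fun i ir => le_trans (mmax i ir) Ms).
  by rewrite -!big_seq p1 pm1 !mul1r; exact.
pose q := \sum_(i <- r | i != i0) p i.
have pq : p i0 + q = 1 by rewrite -p1 (bigD1_seq i0).
have pmq : p i0 * m i0 + \sum_(i <- r | i != i0) p i * m i = 1.
  by rewrite -pm1 [RHS](bigD1_seq i0).
have pi0 : 0 < p i0 by exact: lt_le_trans (pa _ i0r).
(* The largest atom is not alone: it would then equal the mean [1], yet it exceeds [s >= 1]. Any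
   other atom has mass at least [a]. *)
have qa : a <= q.
  have [/hasP[j jr ji0]|/hasPn none] := boolP (has (fun i => i != i0) r).
    rewrite /q -big_filter (bigD1_seq j) ?mem_filter ?ji0 ?filter_uniq//=.
    apply: ler_wpDr; last exact: pa.
    rewrite big_seq_cond sumr_ge0// => i /andP[+ _].
    by rewrite mem_filter => /andP[_ ir]; exact: p0.
  exfalso; move: pmq pq; rewrite /q !big1_seq ?addr0; first last.
  - by move=> i /andP[ii0 /none]; rewrite ii0.
  - by move=> i /andP[ii0 /none]; rewrite ii0.
  by move=> + p1'; rewrite p1' mul1r; lra.
(* The other atoms are clipped at [s], and [M] absorbs the excess so that the mean stays [1]. *)
pose n i := Num.min (m i) s.
pose M := m i0 + (\sum_(i <- r | i != i0) p i * (m i - n i)) / p i0.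
have diff0 : 0 <= \sum_(i <- r | i != i0) p i * (m i - n i).
  rewrite big_seq_cond sumr_ge0// => i /andP[ir _].
  by rewrite mulr_ge0 ?p0// subr_ge0 ge_min lexx.
have mM : m i0 <= M by rewrite lerDl divr_ge0// ltW.
have i0s : 0 <= m i0 by exact: le_trans s0 (ltW sM).
have as1 : 1 <= 2 * a * m i0 ^+ 2.
  by rewrite -[leLHS]s2 ler_pM2l// lerXn2r ?nnegrE// ltW.
have nMmean : p i0 * M + \sum_(i <- r | i != i0) p i * n i = 1.
  rewrite -pmq /M mulrDr mulrCA divff ?gt_eqF// mulr1 -addrA -big_split/=.
  by congr (_ + _); apply: eq_bigr => i _; ring.
have step : \sum_(i <- r) p i * gauss a (m i) <=
    p i0 * gauss a M + \sum_(i <- r | i != i0) p i * gauss a (n i).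
  rewrite (bigD1_seq i0)//=.
  have h1 : p i0 * gauss a (m i0) <= p i0 * gauss a M
     + gauss_slope a (m i0) * \sum_(i <- r | i != i0) p i * (m i - n i).
    have := gauss_convex_tangent_le a0 i0s as1 mM.
    rewrite -(ler_pM2l pi0) mulrBr lerBlDr => /le_trans; apply.
    rewrite lerD2l /M addrAC subrr add0r mulrCA [p i0 * _]mulrC divfK//.
    by rewrite gt_eqF.
  have h2 : \sum_(i <- r | i != i0) p i * gauss a (m i)
      + gauss_slope a (m i0) * (\sum_(i <- r | i != i0) p i * (m i - n i))
     <= \sum_(i <- r | i != i0) p i * gauss a (n i).
    rewrite mulr_sumr -big_split/= big_seq_cond [leRHS]big_seq_cond.
    apply: ler_sum => i /andP[ir _].
    rewrite mulrCA -mulrDr ler_wpM2l ?p0//.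
    rewrite /n; have [ms|sm] := leP (m i) s; first by rewrite subrr mulr0 addr0.
    by apply: gauss_clip_le => //; rewrite ?s2 ?(ltW sm)// mmax.
  lra.
apply: le_trans step _.
have q0 : 0 < q by exact: lt_le_trans qa.
have ns i : i != i0 -> n i <= s by rewrite /n ge_min lexx orbT.
have G1 : gauss a 1 = expR (- a) by rewrite /gauss expr1n mulr1.
pose z := (\sum_(i <- r | i != i0) p i * n i) / q.
have zq : z * q = \sum_(i <- r | i != i0) p i * n i by rewrite divfK// gt_eqF.
have qE : q = 1 - p i0 by apply/eqP; rewrite eq_sym subr_eq addrC pq.
(* If the mean [z] of the clipped atoms is nonnegative, they merge at [z], where [z <= 1] because
   [M >= 1]. If [z < 0], the values [(p i0)^-1 <= M] and [0] have mean [1] and only increase the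
   gaussians. *)
have [z0|z0] := leP 0 z.
  have z1 : z <= s.
    apply: (le_trans _ s1); rewrite -(ler_pM2r q0) zq.
    have : p i0 * 1 <= p i0 * M by rewrite ler_pM2l// (le_trans s1)// (le_trans (ltW sM)).
    by rewrite qE; lra.
  apply: le_trans (lerD (lexx _) (tangent _ z _ z0 z1 ns (esym zq))) _.
  rewrite G1 -/q qE; apply: gauss_two_point_le => //; first exact: pa.
    by rewrite -qE.
  by rewrite -qE -nMmean -zq [z * q]mulrC.
apply: (@le_trans _ _ (p i0 * gauss a (p i0)^-1 + (1 - p i0) * gauss a 0)).
  apply: lerD.
    rewrite ler_pM2l//; apply: gauss_nincr => //; first by rewrite invr_ge0 ltW.
    rewrite -[leLHS]mul1r ler_pdivrMr// mulrC.
    have : z * q <= 0 by rewrite mulr_le0_ge0 ?ltW.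
    by rewrite zq -nMmean; lra.
  rewrite -qE /q mulr_suml big_seq_cond [leRHS]big_seq_cond.
  by apply: ler_sum => i /andP[ir _]; rewrite ler_wpM2l ?p0// gauss_le0.
rewrite G1; apply: gauss_two_point_le => //; first exact: pa.
  by rewrite -qE.
by rewrite mulr0 addr0 divff// gt_eqF.
Qed.

(* Substituting [m i = 1 - t * x i / (2 * a)] turns the summand into a gaussian. *)
Lemma exp_centered_step_le (R : realType) (I : eqType) (r : seq I) (w x : I -> R)
    (a W t : R) :
  0 < a -> a <= 1 / 2 -> uniq r -> 0 < W -> (forall i, i \in r -> a * W <= w i) ->
  \sum_(i <- r) w i = W -> \sum_(i <- r) w i * x i = 0 ->
  \sum_(i <- r) w i * expR (t * x i - t ^+ 2 / (4 * a) * x i ^+ 2) <= W.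
Proof.
move=> a0 a2 ur W0 wa wW wx0.
have Wn0 : W != 0 by rewrite gt_eqF.
have an0 : a != 0 by rewrite gt_eqF.
have pa i : i \in r -> a <= w i / W by move=> ir; rewrite ler_pdivlMr// wa.
have p1 : \sum_(i <- r) w i / W = 1 by rewrite -mulr_suml wW divff.
have pm1 : \sum_(i <- r) w i / W * (1 - t * x i / (2 * a)) = 1.
  under eq_bigr => i _.
    rewrite (_ : _ * _ = w i / W - t / (2 * a) / W * (w i * x i)); last first.
      by field; rewrite Wn0 an0.
    over.
  by rewrite sumrB p1 -mulr_sumr wx0 mulr0 subr0.
have := gauss_average_le a0 a2 ur pa p1 pm1.
under eq_bigr => i _.
  rewrite (_ : w i / W * _ = gauss a 1 / W *
      (w i * expR (t * x i - t ^+ 2 / (4 * a) * x i ^+ 2))); last first.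
    rewrite /gauss (_ : - a * (1 - _) ^+ 2 = - a * 1 ^+ 2 +
      (t * x i - t ^+ 2 / (4 * a) * x i ^+ 2)); last by field.
    by rewrite expRD; field.
  over.
rewrite -mulr_sumr -mulrA -[leRHS]mulr1 ler_pM2l ?gauss_gt0//.
by rewrite mulrC ler_pdivrMr// mul1r.
Qed.

(** * Cubes of a homogeneous atomic filtration *)

Section cubes.
Context {d : measure_display} {T : measurableType d} {R : realType}.
Variables (P : probability T R) (F D : nat -> set (set T)) (alpha : R).
Hypotheses (FD : atomic_filtration F D) (homD : homogeneous P D alpha).
Hypothesis alpha0 : 0 < alpha.
Implicit Types Q : set T.

Lemma cube_filtration n Q : D n Q -> F n Q.
Proof. by case: FD => _ /(_ n)[_ + _ _]; exact. Qed.

Lemma cube_measurable n Q : D n Q -> measurable Q.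
Proof. by move=> /cube_filtration; case: FD => -[_ + _ _ _] _; exact. Qed.

Lemma cube_cover n x : exists2 Q, D n Q & Q x.
Proof.
case: FD => -[/(_ n)[F0 FC _] _ _ _ _] /(_ n)[_ _ _ Fu].
have [S [SD TS]] := Fu _ (FC _ F0).
have : (setT `\` set0) x by rewrite setD0.
by rewrite TS => -[Q /SD DQ Qx]; exists Q.
Qed.

Lemma cube_inj n Q Q' x : D n Q -> D n Q' -> Q x -> Q' x -> Q = Q'.
Proof.
move=> DQ DQ' Qx Q'x; apply: contrapT => QQ'.
case: FD => _ /(_ n)[_ _ /(_ _ _ DQ DQ' QQ') QQ'0 _].
by have : (Q `&` Q') x by []; rewrite QQ'0.
Qed.

(** [Q] belongs to [F n.+1], hence is a union of cubes of [D n.+1]; the one through [x] must be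
    [Q']. *)
Lemma cube_nested n Q Q' x : D n Q -> D n.+1 Q' -> Q x -> Q' x -> Q' `<=` Q.
Proof.
move=> DQ DQ' Qx Q'x.
case: FD => -[_ _ Fmon _ _] /(_ n.+1)[_ _ _ /(_ Q)].
case; first exact/Fmon/cube_filtration.
move=> S [SD QS]; move: Qx; rewrite QS => -[Q'' SQ'' Q''x].
rewrite (cube_inj DQ' (SD _ SQ'') Q'x Q''x) => y Q''y.
by exists Q''.
Qed.

Lemma cube_ancestor n k Q : D n Q -> Q !=set0 -> (k <= n)%N ->
  exists2 Q', D k Q' & Q `<=` Q'.
Proof.
elim: n Q => [|n IH] Q DQ Q0; first by rewrite leqn0 => /eqP ->; exists Q.
rewrite leq_eqVlt => /predU1P[->|]; first by exists Q.
rewrite ltnS => kn; have [x Qx] := Q0.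
have [Q' DQ' Q'x] := cube_cover n x.
have [|Q'' DQ'' Q'Q''] := IH Q' DQ' _ kn; first by exists x.
by exists Q'' => //; apply: subset_trans Q'Q''; exact: (cube_nested DQ' DQ Q'x Qx).
Qed.

Lemma cube0 Q : D 0%N Q -> Q !=set0 -> Q = setT.
Proof.
move=> /cube_filtration; case: FD => -[_ _ _ -> _] _ [->|//] [x] //.
Qed.

(** Homogeneity passes positivity down from the root. Nonemptiness is asked for because [D 0] may
    contain the empty set. *)
Lemma cube_gt0 n Q : D n Q -> Q !=set0 -> (0 < P Q)%E.
Proof.
elim: n Q => [|n IH] Q DQ [x Qx].
  by rewrite (cube0 DQ) ?probability_setT; [|exists x].
have [Q' DQ' Q'x] := cube_cover n x.
have QQ' := cube_nested DQ' DQ Q'x Qx.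
apply: lt_le_trans (homD DQ' (conj DQ QQ')).
by rewrite mule_gt0 ?lte_fin//; apply: IH => //; exists x.
Qed.

(** * Masses and integrals over the children of a cube *)

Definition cube_mass Q : R := fine (P Q).

Lemma cube_massE n Q : D n Q -> P Q = (cube_mass Q)%:E.
Proof. by move=> /cube_measurable mQ; rewrite fineK// fin_num_measure. Qed.

Lemma cube_mass_gt0 n Q : D n Q -> Q !=set0 -> 0 < cube_mass Q.
Proof. by move=> DQ Q0; rewrite -lte_fin -(cube_massE DQ); exact: (cube_gt0 DQ Q0). Qed.

Lemma child_mass_ge n Q Q' : D n Q -> children D n Q Q' ->
  alpha * cube_mass Q <= cube_mass Q'.
Proof.
move=> DQ chQ'; rewrite -lee_fin EFinM -(cube_massE DQ) -(cube_massE chQ'.1).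
exact: (homD DQ chQ').
Qed.

Lemma child_nonempty n Q Q' : D n Q -> Q !=set0 -> children D n Q Q' -> Q' !=set0.
Proof.
move=> DQ Q0 chQ'; apply/set0P/eqP => Q'0.
have := child_mass_ge DQ chQ'.
rewrite Q'0 /cube_mass measure0/= leNgt => /negP; apply.
by rewrite mulr_gt0// (cube_mass_gt0 DQ).
Qed.

Lemma trivIset_children n Q (E : set T) :
  trivIset (children D n Q) (fun Q' => Q' `&` E).
Proof.
move=> Q1 Q2 [D1 _] [D2 _] [x [[Q1x _] [Q2x _]]].
exact: (cube_inj D1 D2 Q1x Q2x).
Qed.

Lemma bigcup_children n Q (E : set T) : D n Q ->
  \bigcup_(Q' in children D n Q) (Q' `&` E) = Q `&` E.
Proof.
move=> DQ; apply/seteqP; split => [x [Q' [_ Q'Q] [Q'x Ex]]|x [Qx Ex]].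
  by split => //; exact: Q'Q.
have [Q' DQ' Q'x] := cube_cover n.+1 x.
by exists Q' => //; split => //; exact: (cube_nested DQ DQ' Qx Q'x).
Qed.

(** More than [alpha^-1] disjoint children, each of mass at least [alpha * cube_mass Q], would
    outweigh [Q]. *)
Lemma finite_children n Q : D n Q -> Q !=set0 -> finite_set (children D n Q).
Proof.
move=> DQ Q0; apply: contrapT => /infinite_set_fset inf.
have Qgt0 := cube_mass_gt0 DQ Q0.
have [B Bch Bsize] := inf (Num.truncn alpha^-1).+1.
have finB : finite_set [set` B] by exact: finite_fset.
have mB Q' : [set` B] Q' -> measurable (Q' `&` setT).
  by move=> /Bch[/cube_measurable]; rewrite setIT.
have := measure_fin_bigcup P finB (sub_trivIset Bch (@trivIset_children n Q setT)) mB.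
have : (P (\bigcup_(Q' in [set` B]) (Q' `&` setT)) <= P Q)%E.
  apply: le_measure; rewrite ?inE; [exact: fin_bigcup_measurable|exact: cube_measurable DQ|].
  by move=> x [Q' /Bch[_ Q'Q] [/Q'Q]].
move=> /[swap] ->; rewrite leNgt => /negP; apply.
rewrite -fsbig_seq//= (cube_massE DQ).
apply: (@lt_le_trans _ _ (\sum_(Q' <- B) (alpha * cube_mass Q)%:E)%E); last first.
  rewrite big_seq [leRHS]big_seq; apply: lee_sum => Q' /Bch chQ'.
  by rewrite setIT (cube_massE chQ'.1) lee_fin; exact: (child_mass_ge DQ chQ').
rewrite sumEFin lte_fin big_const_seq count_predT iter_addr_0.
rewrite -mulr_natr mulrAC -[ltLHS]mul1r ltr_pM2r//.
rewrite -(ltr_pM2l (_ : 0 < alpha^-1)) ?invr_gt0// mulrA mulVf ?gt_eqF// mul1r mulr1.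
by apply: lt_le_trans (truncnS_gt _) _; rewrite ler_nat.
Qed.

Lemma measure_children n Q (E : set T) : D n Q -> Q !=set0 -> measurable E ->
  P (Q `&` E) = (\sum_(Q' \in children D n Q) P (Q' `&` E))%E.
Proof.
move=> DQ Q0 mE; rewrite -(bigcup_children E DQ).
rewrite measure_fin_bigcup//; first exact: finite_children.
  exact: trivIset_children.
by move=> Q' [/cube_measurable mQ' _]; exact: measurableI.
Qed.

Lemma Rintegral_children n Q (f : T -> R) : D n Q -> Q !=set0 ->
  P.-integrable setT (EFin \o f) ->
  Rintegral P Q f = \sum_(Q' \in children D n Q) Rintegral P Q' f.
Proof.
move=> DQ Q0 intf; have finC := finite_children DQ Q0.
(* Set to empty off the children, since measurability is required at every index. *)
pose G Q' := if Q' \in children D n Q then Q' else set0.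
have GE Q' : Q' \in fset_set (children D n Q) -> G Q' = Q'.
  by rewrite in_fset_set// /G => ->.
have QE : Q = \big[setU/set0]_(Q' <- fset_set (children D n Q)) G Q'.
  rewrite -[LHS]setIT -(bigcup_children _ DQ) -bigsetU_fset_set//.
  by rewrite big_seq [RHS]big_seq; apply: eq_bigr => Q' /GE ->; rewrite setIT.
have mG Q' : measurable (G Q').
  by rewrite /G; case: ifPn => //; rewrite inE => -[/cube_measurable].
rewrite fsbig_finite// /Rintegral {1}QE integral_bigsetU_EFin//.
- rewrite -sum_fine => [|Q' _].
    by rewrite big_seq [RHS]big_seq; apply: eq_bigr => Q' /GE ->.
  by apply: integrable_fin_num => //; exact: integrableS intf.
- move=> Q1 Q2 Q1in Q2in; rewrite GE// GE// => Q12.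
  apply: (@trivIset_children n Q setT); rewrite ?setIT//.
    by move: Q1in; rewrite /= in_fset_set// inE.
  by move: Q2in; rewrite /= in_fset_set// inE.
- by rewrite -QE; apply: measurable_funS (measurable_int _ intf).
Qed.


(** A set that splits no cube of [D n] is the union of the countably many cubes it contains. *)
Lemma saturated_measurable n (A : set T) :
  (forall Q x y, D n Q -> Q x -> Q y -> A x -> A y) -> measurable A.
Proof.
move=> satA; pose S := [set Q | D n Q /\ Q `<=` A].
have -> : A = \bigcup_(Q in S) Q.
  apply/seteqP; split => [x Ax|x [Q [_ QA] /QA//]].
  have [Q DQ Qx] := cube_cover n x; exists Q => //; split => // y Qy.
  exact: satA DQ Qx Qy Ax.
rewrite bigcup_set_type; apply: countable_bigcupT_measurable.
  rewrite (eq_countable (card_setT S)).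
  case: FD => _ /(_ n)[cD _ _ _]; apply: sub_countable cD.
  by apply: subset_card_le => Q [].
by move=> [Q QS] /=; have /set_mem[/cube_measurable] := QS.
Qed.

Lemma cube_setT : D 0%N setT /\ [set: T] !=set0.
Proof.
have T0 : [set: T] !=set0.
  apply/set0P/eqP => T0; have := probability_setT P.
  by rewrite T0 measure0 => /eqP; rewrite eq_sym onee_eq0.
split=> //; have [x _] := T0; have [Q DQ Qx] := cube_cover 0 x.
by rewrite -(cube0 DQ) //; exists x.
Qed.

(** * Exponential maximal inequality *)

Section martingale.
(** An abstract martingale with value [A Q] on the cube [Q], to be used for the averages of [f] and
    for their negatives. *)
Variables (A : set T -> R) (X : nat -> T -> R).
Hypothesis XA : forall n Q x, D n Q -> Q x -> X n x = A Q.
Hypothesis martA : forall n Q, D n Q -> Q !=set0 ->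
  \sum_(Q' \in children D n Q) cube_mass Q' * A Q' = cube_mass Q * A Q.
Hypothesis alpha_half : alpha <= 1 / 2.

(** Only increments up to time [n] enter, so [qvar n] is constant on the cubes of [D n]. *)
Definition qvar n x : R := \sum_(k < n) (X k.+1 x - X k x) ^+ 2.

Lemma qvarS n x : qvar n.+1 x = qvar n x + (X n.+1 x - X n x) ^+ 2.
Proof. by rewrite /qvar big_ord_recr. Qed.

Lemma process_cst n k Q x y : D n Q -> Q x -> Q y -> (k <= n)%N -> X k x = X k y.
Proof.
move=> DQ Qx Qy kn; have Q0 : Q !=set0 by exists x.
have [Q' DQ' QQ'] := cube_ancestor DQ Q0 kn.
by rewrite !(XA DQ')//; exact: QQ'.
Qed.

Lemma qvar_cst n Q x y : D n Q -> Q x -> Q y -> qvar n x = qvar n y.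
Proof.
move=> DQ Qx Qy; apply: eq_bigr => -[k kn] _ /=.
by rewrite !(process_cst DQ Qx Qy)// ltnW.
Qed.

Section crossing.
Variables lam B : R.

(** The bound on [qvar] is part of the event, which keeps null sets out of the induction over
    cubes. *)
Definition crossing n := [set x | lam < X n x /\ qvar n x <= B].

(** Induction on the length [N] peels off the first time [n] and passes to the children. *)
Definition crossing_between n N :=
  \bigcup_(k in [set k | n <= k <= n + N]%N) crossing k.

Lemma crossing_cst n Q x y : D n Q -> Q x -> Q y -> crossing n x -> crossing n y.
Proof.
move=> DQ Qx Qy; rewrite /crossing/= (process_cst DQ Qx Qy)//.
by rewrite (qvar_cst DQ Qx Qy).
Qed.

Lemma crossing_measurable n : measurable (crossing n).
Proof. by apply: (@saturated_measurable n) => Q x y; exact: crossing_cst. Qed.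

Lemma crossing_between_measurable n N : measurable (crossing_between n N).
Proof. by apply: bigcup_measurable => k _; exact: crossing_measurable. Qed.

Lemma crossing_between0 n : crossing_between n 0 = crossing n.
Proof.
rewrite /crossing_between addn0 (_ : [set k | _] = [set n]) ?bigcup_set1//.
by apply/seteqP; split => [k /=|k ->/=]; rewrite -?eqn_leq ?leqnn// => /eqP.
Qed.

Lemma crossing_betweenS n N :
  crossing_between n N.+1 = crossing n `|` crossing_between n.+1 N.
Proof.
apply/seteqP; split => x.
  move=> [k /=/andP[]]; rewrite leq_eqVlt => /predU1P[<- _|nk kN]; first by left.
  by right; exists k => //=; rewrite nk addSnnS.
move=> [cx|[k /= /andP[nk kN] cx]].
  by exists n => //=; rewrite leqnn leq_addr.
by exists k => //=; rewrite ltnW// -addSnnS.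
Qed.

(* Without a crossing at time [n] the mass splits among the children, where the
   one-step estimate absorbs the new increment. *)
Lemma measure_crossing_between_le t N n Q x : 0 <= t -> D n Q -> Q x ->
  (P (Q `&` crossing_between n N) <= (cube_mass Q *
     expR (t * (X n x - lam) + t ^+ 2 / (4 * alpha) * (B - qvar n x)))%:E)%E.
Proof.
move=> t0; have ca0 : 0 <= t ^+ 2 / (4 * alpha).
  by rewrite divr_ge0 ?sqr_ge0// mulr_ge0// ltW.
(* The stopping step: at a crossing the exponent is nonnegative, so the right-hand side is at least
   the mass of the cube. *)
have now n' N' Q' x' : D n' Q' -> Q' x' -> crossing n' x' ->
    (P (Q' `&` crossing_between n' N') <= (cube_mass Q' *
     expR (t * (X n' x' - lam) + t ^+ 2 / (4 * alpha) * (B - qvar n' x')))%:E)%E.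
  move=> DQ Qx [lamX qB].
  apply: (@le_trans _ _ (P Q')).
    apply: le_measure; rewrite ?inE; last by move=> ? [].
      by apply: measurableI; [exact: cube_measurable DQ|exact: crossing_between_measurable].
    exact: cube_measurable DQ.
  rewrite (cube_massE DQ) lee_fin ler_peMr ?fine_ge0//.
  rewrite -[leLHS]expR0 ler_expR addr_ge0// mulr_ge0 ?subr_ge0//.
  exact: ltW.
elim: N n Q x => [|N IH] n Q x DQ Qx.
  have [cx|ncx] := pselect (crossing n x); first exact: now.
  rewrite crossing_between0 (_ : _ `&` _ = set0).
    by rewrite measure0 lee_fin mulr_ge0 ?fine_ge0 ?expR_ge0.
  apply/seteqP; split => // y [Qy cy].
  by apply: ncx; exact: crossing_cst DQ Qy Qx cy.
have [cx|ncx] := pselect (crossing n x); first exact: now.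
have Q0 : Q !=set0 by exists x.
rewrite crossing_betweenS (_ : _ `&` _ = Q `&` crossing_between n.+1 N); last first.
  apply/seteqP; split => [y [Qy []]//|y [Qy cy]]; last by split => //; right.
  by move=> cy; exfalso; apply: ncx; exact: crossing_cst DQ Qy Qx cy.
have finC := finite_children DQ Q0.
rewrite (measure_children DQ Q0 (crossing_between_measurable _ _)).
set e := expR _.
(* The factor of one step, with conditional mean at most [1] by [exp_centered_step_le]; [e] is the
   factor already known on [Q]. *)
pose v Q' := expR (t * (A Q' - A Q) - t ^+ 2 / (4 * alpha) * (A Q' - A Q) ^+ 2).
apply: (@le_trans _ _ (\sum_(Q' \in children D n Q) (cube_mass Q' * v Q' * e)%:E)%E).
  apply: lee_fsum => // Q' chQ'; have [y Q'y] := child_nonempty DQ Q0 chQ'.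
  have Qy : Q y by exact: chQ'.2.
  apply: le_trans (IH n.+1 Q' y chQ'.1 Q'y) _.
  rewrite lee_fin -[leRHS]mulrA ler_wpM2l ?fine_ge0// -expRD ler_expR.
  rewrite qvarS (qvar_cst DQ Qy Qx) (XA chQ'.1 Q'y) (XA DQ Qy) (XA DQ Qx).
  by rewrite le_eqVlt; apply/orP; left; apply/eqP; ring.
rewrite fsumEFin// lee_fin fsbig_finite//= -mulr_suml ler_wpM2r ?expR_ge0//.
have memC Q' : Q' \in fset_set (children D n Q) -> children D n Q Q'.
  by rewrite in_fset_set// inE.
have mass : \sum_(Q' <- fset_set (children D n Q)) cube_mass Q' = cube_mass Q.
  apply: EFin_inj; rewrite -(cube_massE DQ) -[in RHS](setIT Q).
  rewrite (measure_children DQ Q0 measurableT) fsbig_finite//= -sumEFin.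
  rewrite big_seq [RHS]big_seq; apply: eq_bigr => Q' /memC[DQ' _].
  by rewrite setIT -(cube_massE DQ').
apply: (exp_centered_step_le (w := cube_mass) (x := fun Q' => A Q' - A Q)
  t alpha0 alpha_half) => //.
- exact: fset_uniq.
- exact: (cube_mass_gt0 DQ Q0).
- by move=> Q' /memC chQ'; exact: (child_mass_ge DQ chQ').
- under eq_bigr do rewrite mulrBr.
  rewrite sumrB -mulr_suml mass -fsbig_finite//= martA//.
  by rewrite subrr.
Qed.

(** On the root cube the bound does not depend on the window length, so continuity from below lets
    the window grow. *)
Lemma measure_crossing_le t : 0 <= t -> (forall x, X 0%N x = 0) ->
  (P (\bigcup_n crossing n) <= (expR (- (t * lam) + t ^+ 2 / (4 * alpha) * B))%:E)%E.
Proof.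
move=> t0 X0; have [DT [x _]] := cube_setT.
have -> : \bigcup_n crossing n = \bigcup_N crossing_between 0 N.
  apply/seteqP; split => y [n _ cy]; first by exists n => //; exists n => //=; rewrite leqnn.
  by case: cy => k _ cy; exists k.
have cvgP : P (crossing_between 0 N) @[N --> \oo] -->
    P (\bigcup_N crossing_between 0 N).
  apply: nondecreasing_cvg_mu; first exact: crossing_between_measurable.
    by apply: bigcup_measurable => k _; exact: crossing_between_measurable.
  move=> N M NM; apply/subsetPset => y [k /= kN cy]; exists k => //=.
  by rewrite add0n (leq_trans kN).
rewrite -(cvg_lim _ cvgP)//; apply: lime_le; first by apply/cvg_ex; eexists; exact: cvgP.
apply: nearW => N; rewrite -[crossing_between 0 N]setTI.
apply: le_trans (measure_crossing_between_le N t0 DT (I : [set: T] x)) _.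
rewrite lee_fin X0 /qvar big_ord0 subr0 sub0r mulrN.
by rewrite /cube_mass probability_setT/= mul1r.
Qed.

End crossing.
End martingale.

(** * Conditional expectations and the square function *)

Lemma condE_cubeE n Q (f : T -> R) x : D n Q -> Q x -> condE P D n f x = avg P Q f.
Proof.
move=> DQ Qx; rewrite /condE -(fsbig_widen [set Q]).
- by rewrite fsbig_set1 /condE_cube indicE mem_set// mulr1.
- by move=> _ ->.
- move=> Q' [DQ' Q'Q]; rewrite /= /condE_cube indicE memNset ?mulr0// => Q'x.
  by apply: Q'Q; exact: (cube_inj DQ' DQ Q'x Qx).
Qed.

Lemma Delta_outside n Q (f : T -> R) x : ~ Q x -> Delta P D n Q f x = 0.
Proof.
move=> nQx; rewrite /Delta fsbig1 => [|Q' [_ Q'Q]].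
  by rewrite /condE_cube indicE memNset// mulr0 subr0.
by rewrite /condE_cube indicE memNset ?mulr0// => /Q'Q.
Qed.

Lemma Delta_inside n Q (f : T -> R) x : D n Q -> Q x ->
  Delta P D n Q f x = condE P D n.+1 f x - condE P D n f x.
Proof.
move=> DQ Qx; rewrite (condE_cubeE f DQ Qx) /Delta.
rewrite [X in _ - X]/condE_cube indicE mem_set// mulr1; congr (_ - _).
apply: fsbig_widen => [Q' []//|].
move=> Q' [DQ' nch]; rewrite /= /condE_cube indicE memNset ?mulr0// => Q'x.
by apply: nch; split => //; exact: (cube_nested DQ DQ' Qx Q'x).
Qed.

(** Only the cube of [D n] through [x] contributes, and there [Delta] is the martingale
    increment. *)
Lemma sum_sqr_Delta n (f : T -> R) x : \sum_(Q \in D n) `|Delta P D n Q f x| ^+ 2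
  = (condE P D n.+1 f x - condE P D n f x) ^+ 2.
Proof.
have [Q DQ Qx] := cube_cover n x.
rewrite -(fsbig_widen [set Q]).
- by rewrite fsbig_set1 (Delta_inside f DQ Qx) real_normK ?num_real.
- by move=> _ ->.
- move=> Q' [DQ' Q'Q]; rewrite /= Delta_outside ?normr0 ?expr0n// => Q'x.
  by apply: Q'Q; exact: (cube_inj DQ' DQ Q'x Qx).
Qed.

(** [qvar] is a partial sum of the nonnegative series under the root in [square_fun]. *)
Lemma qvar_condE_le (f : T -> R) (B : R) n x : 0 <= B ->
  (square_fun P D f x <= B%:E)%E -> qvar (fun k => condE P D k f) n x <= B ^+ 2.
Proof.
move=> B0; rewrite /square_fun.
have -> : B%:E = sqrte (B ^+ 2)%:E by rewrite /= sqrtr_sqr ger0_norm.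
rewrite lee_sqrt ?lee_fin ?sqr_ge0// => /(le_trans _) sumB.
rewrite -lee_fin; apply: sumB.
apply: le_trans (nneseries_lim_ge n _); last first.
  by move=> k _ _; rewrite sum_sqr_Delta lee_fin sqr_ge0.
rewrite /qvar -(big_mkord predT (fun k => (condE P D k.+1 f x - condE P D k f x) ^+ 2)).
rewrite -sumEFin; apply: lee_sum => k _.
by rewrite sum_sqr_Delta.
Qed.

Lemma mass_avg n Q (f : T -> R) : D n Q -> Q !=set0 ->
  cube_mass Q * avg P Q f = Rintegral P Q f.
Proof. by move=> DQ Q0; rewrite mulrC divfK// gt_eqF// (cube_mass_gt0 DQ). Qed.

Lemma avg_martingale n Q (f : T -> R) : P.-integrable setT (EFin \o f) ->
  D n Q -> Q !=set0 ->
  \sum_(Q' \in children D n Q) cube_mass Q' * avg P Q' f = cube_mass Q * avg P Q f.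
Proof.
move=> intf DQ Q0; rewrite (mass_avg _ DQ)// (Rintegral_children DQ)//.
apply: eq_fsbigr => Q' /set_mem chQ'.
by rewrite (mass_avg _ chQ'.1)//; exact: (child_nonempty DQ Q0 chQ').
Qed.

(** * Tail bound for the maximal function *)

Lemma mart_max_gtE (f : T -> R) (lam : R) :
  [set x | (lam%:E < mart_max P D f x)%E] =
  \bigcup_n [set x | lam < `|condE P D n f x|].
Proof.
apply/seteqP; split => x /=.
  by move=> /ereal_sup_gt[_ [n _ <-]]; rewrite lte_fin => ?; exists n.
move=> [n _ /=]; rewrite -lte_fin => /lt_le_trans; apply.
by apply: ereal_sup_ubound; exists n.
Qed.

(** Off the null set [N] where some [qvar] exceeds [B], a large absolute value is a crossing by [X]
    or by [Y = - X], which share the same [qvar]. *)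
Lemma measure_mart_max_le (f : T -> R) (lam B t : R) : alpha <= 1 / 2 ->
  P.-integrable setT (EFin \o f) -> Rintegral P setT f = 0 ->
  (\forall x \ae P, forall n, qvar (fun k => condE P D k f) n x <= B) ->
  0 <= t ->
  (P [set x | (lam%:E < mart_max P D f x)%E] <=
    (2 * expR (- (t * lam) + t ^+ 2 / (4 * alpha) * B))%:E)%E.
Proof.
move=> a2 intf f0 aeB t0.
pose X n := condE P D n f; pose Y n x := - X n x.
have XA n Q x : D n Q -> Q x -> X n x = avg P Q f by exact: condE_cubeE.
have YA n Q x : D n Q -> Q x -> Y n x = - avg P Q f.
  by move=> DQ Qx; rewrite /Y (XA _ _ _ DQ Qx).
have martA n Q : D n Q -> Q !=set0 ->
    \sum_(Q' \in children D n Q) cube_mass Q' * avg P Q' f = cube_mass Q * avg P Q f.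
  exact: avg_martingale.
have martNA n Q : D n Q -> Q !=set0 ->
    \sum_(Q' \in children D n Q) cube_mass Q' * - avg P Q' f = cube_mass Q * - avg P Q f.
  move=> DQ Q0; have finC := finite_children DQ Q0.
  rewrite mulrN -(martA _ _ DQ Q0) !fsbig_finite//= -sumrN.
  by apply: eq_bigr => Q' _; rewrite mulrN.
have X0 x : X 0%N x = 0.
  by rewrite (XA _ _ _ cube_setT.1)// /avg f0 mul0r.
have Y0 x : Y 0%N x = 0 by rewrite /Y X0 oppr0.
have qY n x : qvar Y n x = qvar X n x.
  by apply: eq_bigr => k _; rewrite /Y -opprD sqrrN.
have hX := measure_crossing_le XA martA a2 lam B t0 X0.
have hY := measure_crossing_le YA martNA a2 lam B t0 Y0.
pose N := \bigcup_n [set x | B < qvar X n x].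
have mN : measurable N.
  apply: bigcup_measurable => n _; apply: (@saturated_measurable n) => Q x y DQ Qx Qy /=.
  by rewrite (qvar_cst XA DQ Qx Qy).
have mX := bigcup_measurable (P := setT) (fun k _ => crossing_measurable XA lam B k).
have mY := bigcup_measurable (P := setT) (fun k _ => crossing_measurable YA lam B k).
have PN : P N = 0%E.
  apply/negligibleP => //; apply: negligibleS aeB => x [n _ /= qB] /(_ n).
  by rewrite leNgt qB.
rewrite mart_max_gtE mulr_natl mulr2n EFinD.
set CX := \bigcup_n _ in hX mX; set CY := \bigcup_n _ in hY mY.
apply: (@le_trans _ _ (P ((CX `|` CY) `|` N))).
  apply: le_measure; rewrite ?inE.
  - apply: bigcup_measurable => n _; apply: (@saturated_measurable n) => Q x y DQ Qx Qy /=.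
    by rewrite (condE_cubeE f DQ Qx) (condE_cubeE f DQ Qy).
  - by apply: measurableU => //; exact: measurableU.
  move=> x [n _ /=]; have [qB|qB] := leP (qvar X n x) B; last by right; exists n.
  rewrite ltr_normr => /orP[lamX|lamX]; left; [left|right]; exists n => //; split => //.
  by rewrite qY.
apply: (@le_trans _ _ (P (CX `|` CY) + P N)%E).
  by apply: measureU2 => //; exact: measurableU.
by rewrite PN adde0; apply: le_trans (measureU2 _ mX mY) _; exact: leeD.
Qed.

End cubes.

Unset Implicit Arguments.

Theorem theorem2p4 (d : measure_display) (T : measurableType d) (R : realType)
  (P : probability T R) (F D : nat -> set (set T)) (alpha : R) (f : T -> R) :
  atomic_filtration F D ->
  homogeneous P D alpha ->
  0 < alpha -> alpha <= 1 / 2 ->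
  P.-integrable setT (EFin \o f) ->
  (ess_sup P (square_fun P D f) < +oo)%E ->
  Rintegral P setT f = 0 ->
  forall lam : R, 0 < lam ->
  (P [set x | (lam%:E < mart_max P D f x)%E]
     <= 2%:E * expeR (- (alpha * lam ^+ 2)%:E
                      / (ess_sup P (square_fun P D f)) ^+ 2))%E.
Proof.
move=> FD homD a0 a2 intf supf f0 lam lam0.
have sup0 : (0 <= ess_sup P (square_fun P D f))%E.
  have PT : (0 < P setT)%E by rewrite probability_setT.
  apply: (ess_sup_gee PT).
  by apply: nearW => x; exact: sqrte_ge0.
have [B BE] : exists B, ess_sup P (square_fun P D f) = B%:E.
  by exists (fine (ess_sup P (square_fun P D f))); rewrite fineK// ge0_fin_numE.
have B0 : 0 <= B by rewrite -lee_fin -BE.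
have bound t : 0 <= t -> (P [set x | (lam%:E < mart_max P D f x)%E] <=
    (2 * expR (- (t * lam) + t ^+ 2 / (4 * alpha) * B ^+ 2))%:E)%E.
  move=> t0; apply: (measure_mart_max_le FD homD) => //.
  have := ess_sup_ge P (square_fun P D f); rewrite BE.
  by apply: filterS => x fxB n; exact: (qvar_condE_le FD).
(* For [B = 0] the exponent is [-oo] and the right-hand side is [0], so the measure has to
   vanish. *)
have [B_eq0|B_neq0] := eqVneq B 0.
  rewrite BE B_eq0 expe2 mule0 inve0 mulNe gt0_muley ?lte_fin ?mulr_gt0 ?exprn_gt0//=.
  rewrite mule0 leNgt; apply/negP => P0.
  move: bound P0; rewrite B_eq0; case: (P _) => [u bound|/(_ 0 (lexx _))//|//].
  rewrite lte_fin => u0.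
  (* For a positive measure [u], this [t] gives [u * expR (2 / u) <= 2], whereas
     [1 + 2 / u <= expR (2 / u)] makes the left-hand side at least [u + 2]. *)
  have /bound : 0 <= 2 / (u * lam) by rewrite divr_ge0// mulr_ge0// ltW.
  rewrite expr0n/= mulr0 addr0 lee_fin => ule.
  have := expR_ge1Dx (2 / u); rewrite -(ler_pM2l u0).
  have : u * expR (2 / u) <= 2.
    rewrite -ler_pdivlMr ?expR_gt0// -expRN (le_trans ule)//.
    rewrite ler_pM2l// ler_expR le_eqVlt; apply/orP; left; apply/eqP.
    by field; rewrite !gt_eqF.
  by rewrite mulrDr mulr1 mulrCA divff ?gt_eqF//; lra.
have t0 : 0 <= 2 * alpha * lam / B ^+ 2.
  by rewrite divr_ge0 ?sqr_ge0// mulr_ge0 ?mulr_ge0// ltW.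
apply: le_trans (bound _ t0) _.
rewrite BE -EFin_expe inver expf_eq0/= (negPf B_neq0) /= lee_fin.
rewrite ler_pM2l// ler_expR le_eqVlt; apply/orP; left; apply/eqP.
by field; rewrite B_neq0 gt_eqF.
Qed.
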